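(* Let $\mathrm T$ be the 2-dimensional torus with weights $\alpha_i=i\alpha_1$ for $1\le i\le3$ and $\alpha_i=\alpha_4+(i-4)\alpha_1$ for $4\le i\le n$ ($\alpha_1,\alpha_4$ linearly independent), and for $n\ge6$ let $\mathcal A_n=\{(2,4)\}\cup\{(1,k):1<k<n,\ k\ne3\}$. For $t$ in a commutative $\mathbb K$-algebra, denote by $\mathfrak a_{4,n}(t)$ the multiplication given by the brackets $$[e_1,e_i]=e_{i+1}\ (1<i<n,\ i\ne3),\quad[e_2,e_i]=(1-(i-4)t)e_{i+2}\ (3<i<n-1),\quad[e_3,e_i]=te_{i+3}\ (3<i<n-2),$$ the other brackets $[e_i,e_j]$, $i<j$, being zero, and $\mathfrak a_{4,n}=\mathfrak a_{4,n}(0)$. The scheme $\mathfrak L_n^{\mathrm T,\mathcal A_n}$, with local rings denoted $\mathcal O_n$, is given by: 1. for $n=6$, the unique law $\mathfrak a_{4,6}$, and $\mathcal O_6\simeq\mathbb K$; 2. for $n=7,8$, the continuous family $\mathfrak a_{4,n}(t)$, $t\in\mathbb K$, and $\mathcal O_n\simeq\{p/q:p,q\in\mathbb K[u],q(0)\ne0\}\subset\mathbb K(u)$ at each point; 3. for $n\ge9$, the unique law $\mathfrak a_{4,n}$. The canonical deformation of it in the scheme is $\mathfrak a_{4,n}(t)$ with one nilpotent element $t$ of order two, and $\mathcal O_n=\mathbb K+\mathbb K t\simeq\mathbb K[u]/(u^2)$.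
   Context: $\mathbb K$ is an algebraically closed field of characteristic $0$. The torus $\mathrm T$ acts on $\mathbb K^n$ by $t\cdot e_i=\alpha_i(t)e_i$. $\mathfrak L_n^{\mathrm T}$ is the affine scheme of Lie algebra laws on $\mathbb K^n$ admitting the elements of $\mathrm T$ as derivations: its coordinates are $X_{ij}$, $i<j$, with $\alpha_i+\alpha_j=\alpha_{k}$ for some $k\le n$ (necessarily $k=i+j$ here), the law being $[e_i,e_j]=X_{ij}e_{i+j}$, subject to the Jacobi relations $X_{i,j}X_{i+j,k}+X_{j,k}X_{j+k,i}+X_{k,i}X_{k+i,j}=0$ for $i<j<k$ with $\alpha_i+\alpha_j+\alpha_k=\alpha_{i+j+k}\in\{\alpha_1,\dots,\alpha_n\}$ (with $X_{ji}=-X_{ij}$, and $X_{ij}=0$ for pairs that are not coordinates). $\mathfrak L_n^{\mathrm T,\mathcal A_n}$ is the closed subscheme defined by $X_{ij}=1$ for all $(i,j)\in\mathcal A_n$. The canonical deformation of a point $\varphi$ of a scheme of laws is the law over the local ring of the scheme at $\varphi$ whose structure constants are the germs of the coordinate functions. ''Nilpotent of order two'' means $t^2=0$, $t\ne0$. *)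

(* Defs.v *)
From HB Require Import structures.
From mathcomp Require Import all_boot all_order all_algebra.
From mathcomp Require Import boolp.
From mathcomp Require Import mpoly ring.

Set Implicit Arguments.
Unset Strict Implicit.
Unset Printing Implicit Defensive.

Import GRing.Theory.
Local Open Scope ring_scope.
Local Open Scope quotient_scope.

Definition gen_ideal (P : comNzRingType) (G : P -> Prop) : {pred P} :=
  fun p => `[< exists2 s : seq (P * P),
    forall fg, fg \in s -> G fg.2 & p = \sum_(fg <- s) fg.1 * fg.2 >].

Section QuotientRing.
Variables (P : comNzRingType) (G : P -> Prop).

Lemma gen_idealP (p : P) :
  reflect (exists2 s : seq (P * P),
    forall fg, fg \in s -> G fg.2 & p = \sum_(fg <- s) fg.1 * fg.2)
    (p \in gen_ideal G).
Proof. exact: asboolP. Qed.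

Lemma mem_gen_ideal (p : P) : G p -> p \in gen_ideal G.
Proof.
move=> Gp; apply/gen_idealP; exists [:: (1, p)]; last by rewrite big_seq1 mul1r.
by move=> fg; rewrite inE => /eqP ->.
Qed.

Lemma gen_idealMl (a p : P) : p \in gen_ideal G -> a * p \in gen_ideal G.
Proof.
move=> /gen_idealP[s Gs ->]; apply/gen_idealP.
exists [seq (a * fg.1, fg.2) | fg <- s].
  by move=> _ /mapP[fg /Gs Gfg ->].
by rewrite big_map mulr_sumr; apply: eq_bigr => fg _; rewrite mulrA.
Qed.

Fact gen_ideal_zmod_closed : zmod_closed (gen_ideal G).
Proof.
split=> [|x y /gen_idealP[s Gs ->]].
  by apply/gen_idealP; exists [::]; rewrite ?big_nil.
rewrite -mulN1r => /(gen_idealMl (-1)) /gen_idealP[t Gt ->].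
apply/gen_idealP; exists (s ++ t); last by rewrite big_cat.
by move=> fg; rewrite mem_cat => /orP[/Gs|/Gt].
Qed.

HB.instance Definition _ :=
  GRing.isZmodClosed.Build P (gen_ideal G) gen_ideal_zmod_closed.

(* [quot_ring G] may be the zero ring, hence is only a [comPzRingType], while
   the [ideal_quot] of the library requires a proper ideal. *)
Definition quot_ring := Quotient.quot (gen_ideal G : zmodClosed P).
HB.instance Definition _ := GRing.Zmodule.on quot_ring.

Definition quot_class (p : P) : quot_ring := \pi_quot_ring p.

Lemma quot_classP (p q : P) :
  (quot_class p == quot_class q) = (p - q \in gen_ideal G).
Proof. by rewrite /quot_class Quotient.idealrBE. Qed.

Lemma quot_class_repr (x : quot_ring) : quot_class (repr x) = x.
Proof. exact: reprK. Qed.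

Lemma quot_classB : zmod_morphism quot_class.
Proof. by move=> x y; rewrite /quot_class raddfB. Qed.

Definition quot_one : quot_ring := quot_class 1.
Definition quot_mul (x y : quot_ring) := quot_class (repr x * repr y).

Lemma quot_classM p q : quot_class (p * q) = quot_mul (quot_class p) (quot_class q).
Proof.
apply/eqP; rewrite quot_classP.
set p' := repr (quot_class p); set q' := repr (quot_class q).
have dp : p - p' \in gen_ideal G by rewrite -quot_classP quot_class_repr.
have dq : q - q' \in gen_ideal G by rewrite -quot_classP quot_class_repr.
have -> : p * q - p' * q' = q * (p - p') + p' * (q - q').
  by rewrite !mulrBr addrA [q * p]mulrC [q * p']mulrC subrK.
by rewrite rpredD // gen_idealMl.
Qed.

Fact quot_mulA : associative quot_mul.
Proof.
move=> x y z; rewrite -[x]quot_class_repr -[y]quot_class_repr -[z]quot_class_repr.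
by rewrite -!quot_classM mulrA.
Qed.

Fact quot_mulC : commutative quot_mul.
Proof. by move=> x y; rewrite /quot_mul mulrC. Qed.

Fact quot_mul1 : left_id quot_one quot_mul.
Proof.
by move=> x; rewrite -[x]quot_class_repr -quot_classM mul1r.
Qed.

Fact quot_mulDl : left_distributive quot_mul +%R.
Proof.
move=> x y z; rewrite -[x]quot_class_repr -[y]quot_class_repr -[z]quot_class_repr.
have D a b : quot_class a + quot_class b = quot_class (a + b).
  by rewrite /quot_class raddfD.
by rewrite D -!quot_classM D mulrDl.
Qed.

HB.instance Definition _ := GRing.Zmodule_isComPzRing.Build quot_ring
  quot_mulA quot_mulC quot_mul1 quot_mulDl.

HB.instance Definition _ :=
  GRing.isZmodMorphism.Build P quot_ring quot_class quot_classB.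

Fact quot_class_monoid : monoid_morphism quot_class.
Proof. by split=> // p q; rewrite quot_classM. Qed.

HB.instance Definition _ :=
  GRing.isMonoidMorphism.Build P quot_ring quot_class quot_class_monoid.

End QuotientRing.

(* The affine scheme cut out in the affine space of dimension [m] over [K] by
   the polynomials satisfying [G], through its coordinate ring. *)
Section AffineScheme.
Variables (K : fieldType) (m : nat) (G : {mpoly K[m]} -> Prop).

Definition coord_ring := quot_ring G.
HB.instance Definition _ := GRing.ComPzRing.on coord_ring.

Definition coord_class : {mpoly K[m]} -> coord_ring := @quot_class _ G.
HB.instance Definition _ := GRing.RMorphism.on coord_class.

Definition coord_const (c : K) : coord_ring := coord_class c%:MP.

Lemma coord_const_zmod : zmod_morphism coord_const.
Proof. by move=> x y; rewrite /coord_const mpolyCB rmorphB. Qed.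
HB.instance Definition _ :=
  GRing.isZmodMorphism.Build K coord_ring coord_const coord_const_zmod.
Lemma coord_const_monoid : monoid_morphism coord_const.
Proof. by split=> [|x y]; rewrite /coord_const ?rmorph1 // mpolyCM rmorphM. Qed.
HB.instance Definition _ :=
  GRing.isMonoidMorphism.Build K coord_ring coord_const coord_const_monoid.

(* The [K]-rational points, i.e. (for [K] algebraically closed) the closed
   points. *)
Record point := Point {
  point_eval :> {rmorphism coord_ring -> K};
  point_evalC : forall c, point_eval (coord_const c) = c
}.

(* The local ring at [x] is the localization of the coordinate ring at the
   maximal ideal of the functions vanishing at [x]. *)
Section LocalRing.
Variable x : point.

Definition stalk_frac := (coord_ring * {s : coord_ring | x s != 0})%type.

Implicit Types f g h : stalk_frac.

Definition stalk_equiv f g : bool :=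
  `[< exists2 u, x u != 0 & u * (f.1 * val g.2 - g.1 * val f.2) = 0 >].

Lemma stalk_equivP f g :
  reflect (exists2 u, x u != 0 & u * (f.1 * val g.2 - g.1 * val f.2) = 0)
    (stalk_equiv f g).
Proof. exact: asboolP. Qed.

Fact stalk_equiv_refl : reflexive stalk_equiv.
Proof.
move=> f; apply/stalk_equivP; exists 1; last by rewrite subrr mulr0.
by rewrite rmorph1 oner_neq0.
Qed.

Fact stalk_equiv_sym : ssrbool.symmetric stalk_equiv.
Proof.
suff imp f g : stalk_equiv f g -> stalk_equiv g f by move=> f g; apply/idP/idP; apply: imp.
move=> /stalk_equivP[u u0 e]; apply/stalk_equivP; exists u => //.
by rewrite -opprB mulrN e oppr0.
Qed.

Fact stalk_equiv_trans : transitive stalk_equiv.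
Proof.
move=> g f h /stalk_equivP[u u0 eu] /stalk_equivP[v v0 ev]; apply/stalk_equivP.
exists (u * v * val g.2); first by rewrite !rmorphM !mulf_neq0 //; exact: (valP g.2).
have -> : u * v * val g.2 * (f.1 * val h.2 - h.1 * val f.2) =
  v * val h.2 * (u * (f.1 * val g.2 - g.1 * val f.2)) +
  u * val f.2 * (v * (g.1 * val h.2 - h.1 * val g.2)).
  move: f.1 g.1 h.1 (val f.2) (val g.2) (val h.2) => a b c a' b' c'.
  by ring.
by rewrite eu ev !mulr0 addr0.
Qed.

Canonical stalk_equiv_rel :=
  EquivRel stalk_equiv stalk_equiv_refl stalk_equiv_sym stalk_equiv_trans.

Definition stalk := {eq_quot stalk_equiv}.
HB.instance Definition _ := Choice.on stalk.

Definition stalk_class (f : stalk_frac) : stalk := \pi_stalk f.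

Lemma stalk_classP f g :
  reflect (stalk_class f = stalk_class g) (stalk_equiv f g).
Proof. by rewrite -eqmodE; exact: eqP. Qed.

Lemma stalk_class_repr (z : stalk) : stalk_class (repr z) = z.
Proof. exact: reprK. Qed.

Lemma stalk_class_ind (Q : stalk -> Prop) :
  (forall f, Q (stalk_class f)) -> forall z, Q z.
Proof. by move=> QQ z; rewrite -[z]stalk_class_repr. Qed.

Lemma stalk_repr_equiv f : stalk_equiv (repr (stalk_class f)) f.
Proof. by apply/stalk_classP; rewrite stalk_class_repr. Qed.

Fact den1_subproof : x 1 != 0.
Proof. by rewrite rmorph1 oner_neq0. Qed.
Fact denM_subproof (s t : {s : coord_ring | x s != 0}) : x (val s * val t) != 0.
Proof. by rewrite rmorphM mulf_neq0 ?(valP s) ?(valP t). Qed.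

Definition den1 : {s : coord_ring | x s != 0} := Sub 1 den1_subproof.
Definition denM s t : {s : coord_ring | x s != 0} :=
  Sub (val s * val t) (denM_subproof s t).

Definition fadd f g : stalk_frac :=
  (f.1 * val g.2 + g.1 * val f.2, denM f.2 g.2).
Definition fopp f : stalk_frac := (- f.1, f.2).
Definition fmul f g : stalk_frac := (f.1 * g.1, denM f.2 g.2).

Definition stalk_zero := stalk_class (0, den1).
Definition stalk_one := stalk_class (1, den1).
Definition stalk_add (y z : stalk) := stalk_class (fadd (repr y) (repr z)).
Definition stalk_opp (y : stalk) := stalk_class (fopp (repr y)).
Definition stalk_mul (y z : stalk) := stalk_class (fmul (repr y) (repr z)).

Lemma stalk_classD f g :
  stalk_add (stalk_class f) (stalk_class g) = stalk_class (fadd f g).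
Proof.
apply/stalk_classP/stalk_equivP.
have /stalk_equivP[u u0] := stalk_repr_equiv f.
have /stalk_equivP[v v0] := stalk_repr_equiv g.
rewrite /fadd /=; move: (repr _) (repr _) => [f1 f2] [g1 g2] /= ev eu.
exists (u * v); first by rewrite rmorphM mulf_neq0.
move: f g ev eu => [a a'] [b b'] /=.
move: (val f2) (val g2) (val a') (val b') => {}f2 {}g2 {}a' {}b' ev eu.
have -> : u * v * ((f1 * g2 + g1 * f2) * (a' * b') - (a * b' + b * a') * (f2 * g2)) =
  v * g2 * b' * (u * (f1 * a' - a * f2)) + u * f2 * a' * (v * (g1 * b' - b * g2)) by ring.
by rewrite eu ev !mulr0 addr0.
Qed.

Lemma stalk_classM f g :
  stalk_mul (stalk_class f) (stalk_class g) = stalk_class (fmul f g).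
Proof.
apply/stalk_classP/stalk_equivP.
have /stalk_equivP[u u0] := stalk_repr_equiv f.
have /stalk_equivP[v v0] := stalk_repr_equiv g.
rewrite /fmul /=; move: (repr _) (repr _) => [f1 f2] [g1 g2] /= ev eu.
exists (u * v); first by rewrite rmorphM mulf_neq0.
move: f g ev eu => [a a'] [b b'] /=.
move: (val f2) (val g2) (val a') (val b') => {}f2 {}g2 {}a' {}b' ev eu.
have -> : u * v * (f1 * g1 * (a' * b') - a * b * (f2 * g2)) =
  v * g1 * b' * (u * (f1 * a' - a * f2)) + u * a * f2 * (v * (g1 * b' - b * g2)) by ring.
by rewrite eu ev !mulr0 addr0.
Qed.

Lemma stalk_classN f : stalk_opp (stalk_class f) = stalk_class (fopp f).
Proof.
apply/stalk_classP/stalk_equivP.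
have /stalk_equivP[u u0] := stalk_repr_equiv f.
rewrite /fopp /=; move: (repr _) => [f1 f2] /= e; exists u; first exact: u0.
move: f e => [a a'] /=; move: (val f2) (val a') => {}f2 {}a' e.
have -> : u * (- f1 * a' - - a * f2) = - (u * (f1 * a' - a * f2)) by ring.
by rewrite e oppr0.
Qed.

Local Ltac stalk_eq :=
  apply/stalk_classP/stalk_equivP; exists 1;
  [exact: den1_subproof | rewrite mul1r /=; ring].

Fact stalk_addA : associative stalk_add.
Proof.
elim/stalk_class_ind=> f; elim/stalk_class_ind=> g; elim/stalk_class_ind=> h.
rewrite !stalk_classD; stalk_eq.
Qed.

Fact stalk_addC : commutative stalk_add.
Proof.
by elim/stalk_class_ind=> f; elim/stalk_class_ind=> g; rewrite !stalk_classD; stalk_eq.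
Qed.

Fact stalk_add0 : left_id stalk_zero stalk_add.
Proof. by elim/stalk_class_ind=> f; rewrite !stalk_classD; stalk_eq. Qed.

Fact stalk_addN : left_inverse stalk_zero stalk_opp stalk_add.
Proof.
by elim/stalk_class_ind=> f; rewrite stalk_classN stalk_classD; stalk_eq.
Qed.

HB.instance Definition _ :=
  GRing.isZmodule.Build stalk stalk_addA stalk_addC stalk_add0 stalk_addN.

Fact stalk_mulA : associative stalk_mul.
Proof.
elim/stalk_class_ind=> f; elim/stalk_class_ind=> g; elim/stalk_class_ind=> h.
rewrite !stalk_classM; stalk_eq.
Qed.

Fact stalk_mulC : commutative stalk_mul.
Proof.
by elim/stalk_class_ind=> f; elim/stalk_class_ind=> g; rewrite !stalk_classM; stalk_eq.
Qed.

Fact stalk_mul1 : left_id stalk_one stalk_mul.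
Proof. by elim/stalk_class_ind=> f; rewrite !stalk_classM; stalk_eq. Qed.

Fact stalk_mulDl : left_distributive stalk_mul stalk_add.
Proof.
elim/stalk_class_ind=> f; elim/stalk_class_ind=> g; elim/stalk_class_ind=> h.
rewrite !(stalk_classM, stalk_classD); stalk_eq.
Qed.

Fact stalk_one_neq0 : stalk_one != stalk_zero.
Proof.
apply/negP => /eqP /stalk_classP /stalk_equivP[u /negP u0].
by rewrite /= mul0r subr0 !mulr1 => u_eq0; apply: u0; rewrite u_eq0 rmorph0.
Qed.

HB.instance Definition _ := GRing.Zmodule_isComNzRing.Build stalk
  stalk_mulA stalk_mulC stalk_mul1 stalk_mulDl stalk_one_neq0.

Definition germ (a : coord_ring) : stalk := stalk_class (a, den1).

Fact germB : zmod_morphism germ.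
Proof.
move=> a b; change (germ (a - b) = stalk_add (germ a) (stalk_opp (germ b))).
by rewrite stalk_classN stalk_classD; stalk_eq.
Qed.
HB.instance Definition _ := GRing.isZmodMorphism.Build coord_ring stalk germ germB.

Fact germM : monoid_morphism germ.
Proof.
split=> // a b; change (germ (a * b) = stalk_mul (germ a) (germ b)).
by rewrite stalk_classM; stalk_eq.
Qed.
HB.instance Definition _ := GRing.isMonoidMorphism.Build coord_ring stalk germ germM.

Definition stalk_scale (c : K) (z : stalk) : stalk := germ (coord_const c) * z.

Fact stalk_scaleA a b z : stalk_scale a (stalk_scale b z) = stalk_scale (a * b) z.
Proof. by rewrite /stalk_scale mulrA -!rmorphM. Qed.
Fact stalk_scale1 : left_id 1 stalk_scale.
Proof. by move=> z; rewrite /stalk_scale !rmorph1 mul1r. Qed.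
Fact stalk_scaleDr : right_distributive stalk_scale +%R.
Proof. by move=> a y z; rewrite /stalk_scale mulrDr. Qed.
Fact stalk_scaleDl z : {morph stalk_scale^~ z : a b / a + b}.
Proof. by move=> a b; rewrite /stalk_scale !rmorphD mulrDl. Qed.
HB.instance Definition _ := GRing.Zmodule_isLmodule.Build K stalk
  stalk_scaleA stalk_scale1 stalk_scaleDr stalk_scaleDl.

Fact stalk_scaleAl (a : K) (y z : stalk) : a *: (y * z) = (a *: y) * z.
Proof. by rewrite /GRing.scale /= /stalk_scale mulrA. Qed.
HB.instance Definition _ := GRing.Lmodule_isLalgebra.Build K stalk stalk_scaleAl.
HB.instance Definition _ := GRing.Lalgebra_isComAlgebra.Build K stalk.

End LocalRing.
End AffineScheme.

(* [basis_vec B n k] is e_k for 1 <= k <= n: the e_k are numbered from 1, the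
   entries of row vectors from 0. *)
Definition basis_vec (B : pzRingType) (n k : nat) : 'rV[B]_n :=
  \row_(i < n) (i.+1 == k)%:R.

(* The alternating bilinear multiplication on B^n whose brackets [e_i, e_j],
   1 <= i < j <= n, are the [c i j]. *)
Definition mult_of_brackets (B : pzRingType) (n : nat)
    (c : nat -> nat -> 'rV[B]_n) (u v : 'rV[B]_n) : 'rV[B]_n :=
  \sum_(i < n) \sum_(j < n | (i < j)%N)
     (u 0 i * v 0 j - u 0 j * v 0 i) *: c i.+1 j.+1.

(* The torus is given through its space T and the linear forms [alpha i] on T
   by which it acts diagonally on the e_i, 1 <= i <= n. *)
Section LawScheme.
Variables (K : fieldType) (T : vectType K) (alpha : nat -> 'Hom(T, K^o)).
Variables (n : nat) (A : pred (nat * nat)).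

Definition coord_pairs : seq (nat * nat) :=
  [seq ij <- [seq (i, j) | i <- iota 1 n, j <- iota 1 n] | (ij.1 < ij.2)%N
    && has (fun k => alpha ij.1 + alpha ij.2 == alpha k) (iota 1 n)].

Definition coord_var (i j : nat) : {mpoly K[size coord_pairs]} :=
  if insub (index (i, j) coord_pairs) is Some k then 'X_k else 0.

(* X_ij, with X_ji = - X_ij and X_ij = 0 if neither (i, j) nor (j, i) is a
   coordinate: at most one of the two terms is nonzero. *)
Definition struct_const (i j : nat) : {mpoly K[size coord_pairs]} :=
  coord_var i j - coord_var j i.

Definition jacobi (i j k : nat) : {mpoly K[size coord_pairs]} :=
  struct_const i j * struct_const (i + j) k
  + struct_const j k * struct_const (j + k) i
  + struct_const k i * struct_const (k + i) j.

(* The relations defining the scheme of all laws on K^n with T as derivations;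
   [normalized_relation] defines its closed subscheme X_ij = 1 for (i, j) in A. *)
Definition jacobi_relation (p : {mpoly K[size coord_pairs]}) : Prop :=
  exists i j k : nat, [/\ (0 < i < j)%N, (j < k)%N, (i + j + k <= n)%N,
    alpha i + alpha j + alpha k = alpha (i + j + k)%N & p = jacobi i j k].

Definition normalized_relation (p : {mpoly K[size coord_pairs]}) : Prop :=
  jacobi_relation p \/ exists2 ij, A ij & p = struct_const ij.1 ij.2 - 1.

Definition law_ring := coord_ring normalized_relation.
Definition law_point := point normalized_relation.
Definition law_const : K -> law_ring := @coord_const _ _ normalized_relation.
Definition law_coord (i j : nat) : law_ring :=
  coord_class normalized_relation (struct_const i j).
HB.instance Definition _ := GRing.ComPzRing.on law_ring.

(* The law over [B] obtained from the universal one, over the coordinate ring,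
   by extension of scalars along [f]. *)
Definition law_along (B : pzRingType) (f : law_ring -> B) :
    'rV[B]_n -> 'rV[B]_n -> 'rV[B]_n :=
  mult_of_brackets (fun i j => f (law_coord i j) *: basis_vec B n (i + j)).

Definition local_ring (x : law_point) := stalk x.
HB.instance Definition _ x := GRing.ComAlgebra.on (local_ring x).

Definition canonical_deformation (x : law_point) :
    'rV[local_ring x]_n -> 'rV[local_ring x]_n -> 'rV[local_ring x]_n :=
  law_along (@germ _ _ _ x : law_ring -> local_ring x).

Definition is_law (mu : 'rV[K]_n -> 'rV[K]_n -> 'rV[K]_n) : Prop :=
  exists x : law_point, law_along x =2 mu.

End LawScheme.

Arguments law_const {K T alpha n A} c.
Arguments is_law {K T} alpha n A mu.
Arguments canonical_deformation {K T alpha n A} x _ _.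

Definition weights4 (V : zmodType) (alpha1 alpha4 : V) (i : nat) : V :=
  if (i <= 3)%N then alpha1 *+ i else alpha4 + alpha1 *+ (i - 4).

Definition A4 (n : nat) : pred (nat * nat) := fun ij =>
  (ij == (2, 4)%N) || [&& ij.1 == 1, 1 < ij.2 < n & ij.2 != 3]%N.

Definition a4_bracket (B : pzRingType) (n : nat) (t : B) (i j : nat) : 'rV[B]_n :=
  if [&& i == 1, 1 < j < n & j != 3]%N then basis_vec B n j.+1
  else if [&& i == 2 & 3 < j < n - 1]%N then
    (1 - (j - 4)%:R * t) *: basis_vec B n (j + 2)
  else if [&& i == 3 & 3 < j < n - 2]%N then t *: basis_vec B n (j + 3)
  else 0.

Definition a4 (B : pzRingType) (n : nat) (t : B) :
    'rV[B]_n -> 'rV[B]_n -> 'rV[B]_n :=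
  mult_of_brackets (a4_bracket n t).
Arguments a4 {B} n t _ _.

(* {p/q : q(0) <> 0} inside K(u). *)
Definition regular_at0 (K : fieldType) (f : {fraction {poly K}}) : Prop :=
  exists p q : {poly K}, q.[0] != 0 /\ f = tofrac p / tofrac q.

(* Main.v *)
Require Import Defs.
From HB Require Import structures.
From mathcomp Require Import all_boot all_order all_algebra.
From mathcomp Require Import boolp mpoly ring zify.

Set Implicit Arguments.
Unset Strict Implicit.
Unset Printing Implicit Defensive.

Import GRing.Theory.
Local Open Scope ring_scope.

(* The coordinates are X_12 and the X_ij with i <= 3 < j and i + j <= n. Once
   the X_1j are 1, the Jacobi relation for (1, 3, k) says that X_3k does not
   depend on k, so all of them equal tau := X_34; the one for (1, 2, k) says
   that X_2,k+1 = X_2k - tau, so X_2k = 1 - (k - 4) tau; and the one for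
   (2, 3, k), which exists only for n >= 9, reduces to 3 tau^2 = 0. Hence the
   coordinate ring is K for n = 6, K[tau] for n = 7, 8 and K[tau]/(tau^2) for
   n >= 9. In the first and third cases it is already local. *)

(** * Bundled morphisms and the universal property of the quotient ring *)

Lemma exists_rmorphism (A B : pzRingType) (f : A -> B) :
  zmod_morphism f -> monoid_morphism f -> exists g : {rmorphism A -> B}, g =1 f.
Proof.
move=> fB fM.
pose g : {rmorphism A -> B} := HB.pack f
  (GRing.isZmodMorphism.Build A B f fB) (GRing.isMonoidMorphism.Build A B f fM).
by exists g.
Qed.

Lemma exists_lrmorphism (K : pzRingType) (A B : lalgType K) (f : A -> B) :
  zmod_morphism f -> monoid_morphism f -> scalable f ->
  exists g : {lrmorphism A -> B}, g =1 f.
Proof.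
move=> fB fM fZ.
pose g : {lrmorphism A -> B} := HB.pack f
  (GRing.isZmodMorphism.Build A B f fB) (GRing.isMonoidMorphism.Build A B f fM)
  (GRing.isScalable.Build K A B *:%R f fZ).
by exists g.
Qed.

Section QuotLift.
Variables (P : comNzRingType) (G : P -> Prop).

Lemma gen_ideal_kernel (B : pzRingType) (f : {rmorphism P -> B}) p :
  (forall q, G q -> f q = 0) -> p \in gen_ideal G -> f p = 0.
Proof.
move=> fG /gen_idealP[s Gs ->]; rewrite rmorph_sum big_seq big1 // => fg /Gs Gfg.
by rewrite rmorphM (fG _ Gfg) mulr0.
Qed.

Lemma quot_class_eq0 p : G p -> quot_class G p = 0.
Proof.
move=> Gp; rewrite -(rmorph0 (@quot_class P G)).
by apply/eqP; rewrite quot_classP subr0 mem_gen_ideal.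
Qed.

(** Applying [f] to a representative is well defined: two representatives of a class differ by an
    element of the ideal, which [f] kills. *)
Lemma quot_lift (B : pzRingType) (f : {rmorphism P -> B}) :
  (forall q, G q -> f q = 0) ->
  exists g : {rmorphism quot_ring G -> B}, forall p, g (quot_class G p) = f p.
Proof.
move=> fG; pose g (x : quot_ring G) := f (repr x).
have gE p : g (quot_class G p) = f p.
  apply/eqP; rewrite -subr_eq0 -rmorphB; apply/eqP/(gen_ideal_kernel fG).
  by rewrite -quot_classP quot_class_repr.
have gB : zmod_morphism g.
  move=> x y; rewrite -[x]quot_class_repr -[y]quot_class_repr -rmorphB !gE.
  exact: rmorphB.
have gM : monoid_morphism g.
  split=> [|x y]; first by rewrite -(rmorph1 (@quot_class P G)) gE rmorph1.
  rewrite -[x]quot_class_repr -[y]quot_class_repr -rmorphM !gE.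
  exact: rmorphM.
have [h hE] := exists_rmorphism gB gM.
by exists h => p; rewrite hE gE.
Qed.

End QuotLift.

(** * Coordinate rings and their localization at a rational point *)

Section Coord.
Variables (K : fieldType) (m : nat) (G : {mpoly K[m]} -> Prop).

(** A tuple [v] satisfying the equations is a [B]-valued point of the scheme; the scalars enter [B]
    through [h]. *)
Lemma coord_lift (B : comNzRingType) (h : {rmorphism K -> B}) (v : 'I_m -> B) :
  (forall q, G q -> mmap h v q = 0) ->
  exists g : {rmorphism coord_ring G -> B},
    (forall p, g (coord_class G p) = mmap h v p) /\
    (forall c, g (coord_const G c) = h c).
Proof.
move=> vG; have [g gE] := quot_lift vG.
by exists g; split=> [p|c]; [exact: gE | rewrite -(mmapC v h); exact: gE].
Qed.

(** Constants and the classes of the variables generate the ring; negation is multiplication by the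
    constant $-1$. *)
Lemma coord_ind (Q : coord_ring G -> Prop) :
  (forall c, Q (coord_const G c)) -> (forall x y, Q x -> Q y -> Q (x + y)) ->
  (forall x y, Q x -> Q y -> Q (x * y)) -> (forall i, Q (coord_class G 'X_i)) ->
  forall z, Q z.
Proof.
move=> QC QD QM QX z; rewrite -[z]quot_class_repr.
change (Q (coord_class G (repr z))).
elim/mpolyind: (repr z) => [|c mm p _ _ IHp].
  by rewrite -mpolyC0; exact: QC.
rewrite rmorphD; apply: (QD) => //.
rewrite -mul_mpolyC rmorphM; apply: (QM); first exact: QC.
rewrite mpolyXE_id rmorph_prod /=; elim/big_rec: _ => [|i x _ Qx].
  by rewrite -(rmorph1 (coord_const G)); exact: QC.
apply: (QM) => //; rewrite rmorphXn; elim: (mm i) => [|k IHk].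
  by rewrite expr0 -(rmorph1 (coord_const G)); exact: QC.
by rewrite exprS; apply: (QM) => //; apply: QX.
Qed.

Section Stalk.
Variable x : point G.

Lemma stalk_classE (f : stalk_frac x) :
  stalk_class f * germ x (val f.2) = germ x f.1.
Proof.
change (stalk_mul (stalk_class f) (stalk_class (val f.2, den1 x)) =
  stalk_class (f.1, den1 x)).
rewrite stalk_classM; apply/stalk_classP/stalk_equivP.
by exists 1; [exact: den1_subproof | rewrite mul1r /=; ring].
Qed.

Lemma germ_constE c : germ x (coord_const G c) = c%:A.
Proof. by rewrite -[LHS]mulr1. Qed.

Lemma germ_eq0 a : germ x a = 0 -> exists2 u, x u != 0 & u * a = 0.
Proof.
rewrite -(rmorph0 (germ x)) => /stalk_classP/stalk_equivP[u u0 e].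
by exists u => //; rewrite -e /= mul0r subr0 mulr1.
Qed.

(** Universal property of localization, for a target field in which the images of the denominators
    are inverted. *)
Lemma stalk_lift (F : fieldType) (f : {rmorphism coord_ring G -> F}) :
  (forall s, x s != 0 -> f s != 0) ->
  exists g : {rmorphism stalk x -> F},
    forall z, g (stalk_class z) = f z.1 / f (val z.2).
Proof.
move=> f_neq0; pose g (z : stalk x) := f (repr z).1 / f (val (repr z).2).
have den0 (s : {s : coord_ring G | x s != 0}) : f (val s) != 0.
  by apply: f_neq0; exact: (valP s).
have gE z : g (stalk_class z) = f z.1 / f (val z.2).
  have /stalk_equivP[u u0 e] := stalk_repr_equiv z.
  apply/eqP; rewrite eqr_div ?den0 // -subr_eq0 -!rmorphM -rmorphB.
  (* The cross difference vanishes only after multiplication by [u], but [f u] is nonzero and can be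
     cancelled in the field. *)
  have /eqP := congr1 f e.
  by rewrite rmorphM rmorph0 mulf_eq0 (negbTE (f_neq0 _ u0)).
have gG a : g (germ x a) = f a by rewrite gE rmorph1 divr1.
have gM y z : g (y * z) = g y * g z.
  move: y z; elim/stalk_class_ind=> a; elim/stalk_class_ind=> b.
  change (g (stalk_mul (stalk_class a) (stalk_class b)) =
    g (stalk_class a) * g (stalk_class b)).
  by rewrite stalk_classM !gE /= !rmorphM mulf_div.
have gB : zmod_morphism g.
  elim/stalk_class_ind=> a; elim/stalk_class_ind=> b.
  change (g (stalk_add (stalk_class a) (stalk_opp (stalk_class b))) =
    g (stalk_class a) - g (stalk_class b)).
  rewrite stalk_classN stalk_classD !gE /=.
  by rewrite rmorphD !rmorphM rmorphN -[X in _ = _ + X]mulNr addf_div //; exact: den0.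
have g1 : g 1 = 1 by rewrite -(rmorph1 (germ x)) gG rmorph1.
by have [h hE] := exists_rmorphism gB (conj g1 gM); exists h => z; rewrite hE.
Qed.

(* If the coordinate ring is local at [x], localization does nothing. *)
Lemma germ_bij (x_unit : forall s, x s != 0 -> exists s', s' * s = 1) :
  bijective (germ x).
Proof.
have ex z : {a | germ x a = z}.
  apply: cid.
  move: z; elim/stalk_class_ind=> f /=.
  have [s' s'1] := x_unit _ (valP f.2).
  exists (f.1 * s'); rewrite rmorphM /= -(stalk_classE f) -mulrA -rmorphM /=.
  by rewrite [_ * s']mulrC s'1 rmorph1 mulr1.
exists (fun z => sval (ex z)) => [a|z]; last exact: (svalP (ex z)).
apply/eqP; rewrite -subr_eq0; apply/eqP.
have /eqP := svalP (ex (germ x a)); rewrite -subr_eq0 -rmorphB => /eqP/germ_eq0.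
case=> u /x_unit[u' u'1] ud; by rewrite -[LHS]mul1r -u'1 -mulrA ud mulr0.
Qed.

(** The isomorphism is [f] after the inverse of [germ x]. It is linear because the germ of the
    constant [c] is [c%:A]. *)
Lemma stalk_iso (B : lalgType K) (f : {rmorphism coord_ring G -> B}) :
  bijective (germ x) -> bijective f -> (forall c, f (coord_const G c) = c%:A) ->
  exists theta : {lrmorphism stalk x -> B}, bijective theta.
Proof.
move=> [g germK gK] fbij fC.
have gB : zmod_morphism g by apply: (can2_zmod_morphism germK).
have gM : monoid_morphism g by apply: (can2_monoid_morphism germK).
have [] := @exists_lrmorphism K (stalk x) B (f \o g).
- by move=> a b /=; rewrite gB rmorphB.
- by split=> [|a b] /=; rewrite ?gM.1 ?gM.2 ?rmorph1 ?rmorphM.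
- move=> c z /=; rewrite -mulr_algl -germ_constE gM.2 germK rmorphM fC.
  by rewrite mulr_algl.
move=> theta thetaE; exists theta; apply: (eq_bij _ (fsym thetaE)).
by apply: bij_comp => //; exists (germ x).
Qed.

End Stalk.
End Coord.

(** * Structure constants of [a4] and the index pairs that carry a coordinate *)

Definition a4_coef (B : pzRingType) (n : nat) (t : B) (i j : nat) : B :=
  if [&& i == 1, 1 < j < n & j != 3]%N then 1
  else if [&& i == 2 & 3 < j < n - 1]%N then 1 - (j - 4)%:R * t
  else if [&& i == 3 & 3 < j < n - 2]%N then t
  else 0.

Definition is_coord4 (n i j : nat) : bool :=
  ((i, j) == (1, 2)) || [&& 0 < i <= 3, 3 < j & i + j <= n]%N.

Section Coef.
Variables (B : pzRingType) (n : nat) (t : B).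

Lemma a4_bracketE i j :
  a4_bracket n t i j = a4_coef n t i j *: basis_vec B n (i + j).
Proof.
rewrite /a4_bracket /a4_coef.
case: ifP => [/andP[/eqP-> _]|_]; first by rewrite scale1r.
case: ifP => [/andP[/eqP-> _]|_]; first by rewrite addnC.
case: ifP => [/andP[/eqP-> _]|_]; first by rewrite addnC.
by rewrite scale0r.
Qed.

Lemma a4_coef_out i j : ~~ is_coord4 n i j -> a4_coef n t i j = 0.
Proof.
rewrite /is_coord4 /a4_coef xpair_eqE; do 3![case: ifP => [ij|_]; first lia].
by [].
Qed.

Lemma a4_coef1 j : (1 < j < n)%N -> j != 3 -> a4_coef n t 1 j = 1.
Proof. by move=> jn j3; rewrite /a4_coef jn j3. Qed.

Lemma a4_coef2 j : (3 < j)%N -> (j + 2 <= n)%N ->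
  a4_coef n t 2 j = 1 - (j - 4)%:R * t.
Proof.
by move=> j3 jn; rewrite /a4_coef /= (_ : (3 < j < n - 1)%N) //; lia.
Qed.

Lemma a4_coef3 j : (3 < j)%N -> (j + 3 <= n)%N -> a4_coef n t 3 j = t.
Proof.
by move=> j3 jn; rewrite /a4_coef /= (_ : (3 < j < n - 2)%N) //; lia.
Qed.

End Coef.

Lemma rmorph_a4_coef (A B : pzRingType) (f : {rmorphism A -> B}) n t i j :
  f (a4_coef n t i j) = a4_coef n (f t) i j.
Proof.
by rewrite /a4_coef !(fun_if f) rmorphB rmorphM rmorph_nat rmorph1 rmorph0.
Qed.

(* The coordinates of the weight [weights4 _ _ i] on alpha_1 and alpha_4. *)
Definition weight_coord1 (i : nat) : nat := if (i <= 3)%N then i else (i - 4)%N.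
Definition weight_coord4 (i : nat) : nat := (3 < i)%N.

(** A disjunction in linear arithmetic, on which [lia] can split. *)
Lemma weight_coord_cases i : (i <= 3 /\ weight_coord1 i = i /\ weight_coord4 i = 0 \/
  3 < i /\ weight_coord1 i = i - 4 /\ weight_coord4 i = 1)%N.
Proof. by rewrite /weight_coord1 /weight_coord4; case: leqP; [left | right]. Qed.

(** * Equality of weights, reduced to equality of natural numbers *)

Section Weights.
Variables (K : fieldType) (charK : [pchar K] =i pred0).
Variables (T : vectType K) (alpha1 alpha4 : 'Hom(T, K^o)).
Hypothesis indep : free [:: alpha1; alpha4].

Lemma free_comb (a b : K) : a *: alpha1 + b *: alpha4 = 0 -> a = 0 /\ b = 0.
Proof.
move=> e; have /freeP fr : free (in_tuple [:: alpha1; alpha4]) by [].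
pose k (i : 'I_2) := if i == 0 then a else b.
have /fr k0 : \sum_(i < 2) k i *: [:: alpha1; alpha4]`_i = 0.
  by rewrite big_ord_recl big_ord1.
by split; [have := k0 0 | have := k0 1].
Qed.

Lemma natr_inj_pchar0 (p q : nat) : p%:R = q%:R :> K -> p = q.
Proof.
have /pcharf0P K0 := charK.
wlog le_pq : p q / (p <= q)%N.
  by move=> W; case/orP: (leq_total p q) => le e; [|symmetry]; apply: W.
move=> e; have := K0 (q - p)%N; rewrite natrB // e subrr eqxx.
by move/esym; rewrite subn_eq0 => qp; apply/eqP; rewrite eqn_leq le_pq.
Qed.

Local Notation alpha := (weights4 alpha1 alpha4).

Let alphaE i : alpha i = (weight_coord1 i)%:R *: alpha1 + (weight_coord4 i)%:R *: alpha4.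
Proof.
rewrite /weights4 /weight_coord1 /weight_coord4 ltnNge; case: ifP => _ /=.
  by rewrite scale0r addr0 scaler_nat.
by rewrite scale1r scaler_nat addrC.
Qed.

Let comb_inj p q p' q' :
  p%:R *: alpha1 + q%:R *: alpha4 = p'%:R *: alpha1 + q'%:R *: alpha4 ->
  p = p' /\ q = q'.
Proof.
move/eqP; rewrite -subr_eq0 opprD addrACA -!scalerBl => /eqP/free_comb[].
by move=> /eqP; rewrite subr_eq0 => /eqP/natr_inj_pchar0 ->
  /eqP; rewrite subr_eq0 => /eqP/natr_inj_pchar0 ->.
Qed.

(** Independence of $\alpha_1,\alpha_4$ separates the two coefficients, and characteristic $0$ makes
    them comparable as natural numbers. *)
Lemma weights4_add i j k :
  (alpha i + alpha j == alpha k) =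
  (weight_coord1 i + weight_coord1 j == weight_coord1 k)%N &&
  (weight_coord4 i + weight_coord4 j == weight_coord4 k)%N.
Proof.
rewrite !alphaE addrACA -!scalerDl -!natrD; apply/eqP/andP => [|[/eqP-> /eqP->]] //.
by move/comb_inj=> [-> ->].
Qed.

Lemma weights4_add3 i j k l :
  (alpha i + alpha j + alpha k == alpha l) =
  (weight_coord1 i + weight_coord1 j + weight_coord1 k == weight_coord1 l)%N &&
  (weight_coord4 i + weight_coord4 j + weight_coord4 k == weight_coord4 l)%N.
Proof.
rewrite !alphaE [X in X + (_ *: _ + _) == _]addrACA -!scalerDl -!natrD.
rewrite addrACA -!scalerDl -!natrD.
apply/eqP/andP => [|[/eqP-> /eqP->]] //.
by move/comb_inj=> [-> ->].
Qed.

(** No weight contains $2\alpha_4$, so at most one index exceeds 3. If none does, the sum must be at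
    most $3\alpha_1$, which leaves only $(1,2)$; if $j$ does, the sum is $\alpha_4+(i+j-4)\alpha_1$,
    a weight exactly when $i+j\le n$. *)
Lemma mem_coord_pairs4 n i j : (3 <= n)%N ->
  ((i, j) \in coord_pairs alpha n) = is_coord4 n i j.
Proof.
move=> n3; rewrite mem_filter /= /is_coord4 xpair_eqE.
apply/idP/idP => [/andP[/andP[ij /hasP[k]]]|ij].
  rewrite mem_iota weights4_add => kn /andP[/eqP ea /eqP eb].
  move=> /allpairsP[[i' j'] /= []]; rewrite !mem_iota => i'n j'n [ei ej].
  subst i' j'; have := weight_coord_cases i; have := weight_coord_cases j.
  by have := weight_coord_cases k; lia.
apply/andP; split; last by apply/allpairs_f; rewrite mem_iota; lia.
apply/andP; split; first by lia.
apply/hasP; exists (i + j)%N; first by rewrite mem_iota; lia.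
rewrite weights4_add.
have := weight_coord_cases i; have := weight_coord_cases j.
by have := weight_coord_cases (i + j); lia.
Qed.

(** Since $i+j+k\ge6$, the right side contains $\alpha_4$ exactly once, so exactly one index,
    necessarily $k$, exceeds 3. The Jacobi relations are thus those of $(1,2,k)$, $(1,3,k)$ and
    $(2,3,k)$. *)
Lemma jacobi_triple4 i j k : (0 < i < j)%N -> (j < k)%N ->
  alpha i + alpha j + alpha k = alpha (i + j + k)%N <->
  (j <= 3 < k)%N.
Proof.
move=> ij jk; have wi := weight_coord_cases i; have wj := weight_coord_cases j.
have wk := weight_coord_cases k; have ws := weight_coord_cases (i + j + k).
split=> [/eqP|jk3]; first rewrite weights4_add3; try lia.
apply/eqP; rewrite weights4_add3; lia.
Qed.

(** * The coordinate ring of the scheme: its generator [tau] and the relations on it *)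

Section LawRing.
Variables (n : nat) (n6 : (6 <= n)%N).

Local Notation G := (@normalized_relation K T alpha n (A4 n)).
Local Notation L := (law_ring alpha n (A4 n)).
Local Notation X := (law_coord alpha n (A4 n)).
Local Notation tau := (X 3 4).

Let n3 : (3 <= n)%N. Proof. by lia. Qed.

Lemma coord_var_out i j : ~~ is_coord4 n i j -> coord_var alpha n i j = 0.
Proof.
move=> ij; rewrite /coord_var; case: insubP => //= k.
by rewrite index_mem mem_coord_pairs4 // (negbTE ij).
Qed.

Lemma is_coord4_lt i j : is_coord4 n i j -> (i < j)%N.
Proof. by rewrite /is_coord4 xpair_eqE; lia. Qed.

Lemma struct_const_lt i j : (i < j)%N ->
  struct_const alpha n i j = coord_var alpha n i j.
Proof.
move=> ij; rewrite /struct_const [X in _ - X]coord_var_out ?subr0 //.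
by apply/negP => /is_coord4_lt; lia.
Qed.

Lemma law_coordN i j : X i j = - X j i.
Proof. by rewrite /law_coord -rmorphN /struct_const opprB. Qed.

Lemma law_coord_out i j : ~~ is_coord4 n i j -> ~~ is_coord4 n j i -> X i j = 0.
Proof.
move=> ij ji; rewrite /law_coord /struct_const !coord_var_out //.
by rewrite subrr rmorph0.
Qed.

Lemma law_coord_norm i j : A4 n (i, j) -> X i j = 1.
Proof.
move=> Aij; apply/eqP; rewrite -subr_eq0 -(rmorph1 (coord_class _)) -rmorphB.
apply/eqP/quot_class_eq0; by right; exists (i, j).
Qed.

Lemma law_coord1 j : (1 < j < n)%N -> j != 3 -> X 1 j = 1.
Proof. by move=> jn j3; rewrite law_coord_norm // /A4 /= jn j3. Qed.

Lemma law_jacobi i j k : (0 < i < j)%N -> (j <= 3 < k)%N -> (i + j + k <= n)%N ->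
  X i j * X (i + j) k + X j k * X (j + k) i + X k i * X (k + i) j = 0.
Proof.
move=> ij jk ijk; rewrite /law_coord -!rmorphM -!rmorphD.
apply: quot_class_eq0; left; exists i, j, k; split=> //; first lia.
by apply/jacobi_triple4 => //; lia.
Qed.

Lemma law_coord3 m : (m + 7 <= n)%N -> X 3 (4 + m) = tau.
Proof.
elim: m => [|m IHm] mn //.
(* As $X_{13}=0$ and the $X_{1j}$ that occur are 1, this relation reads $-X_{3,4+m}+X_{3,5+m}=0$. *)
have := @law_jacobi 1 3 (4 + m) isT isT ltac:(lia).
rewrite (@law_coord_out 1 3) // mul0r add0r.
rewrite [X (_ + _) 1]law_coordN [X (_ + m) 1]law_coordN [X _ 3]law_coordN.
rewrite !law_coord1; try lia.
rewrite IHm; last lia.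
rewrite mulNr mulrN !mul1r mulr1 opprK addn1 -addnS => /eqP.
by rewrite addrC subr_eq0 => /eqP.
Qed.

Lemma law_coord2 m : (m + 6 <= n)%N -> X 2 (4 + m) = 1 - m%:R * tau.
Proof.
elim: m => [|m IHm] mn; first by rewrite law_coord_norm // mul0r subr0.
(* Here the relation becomes $\tau-X_{2,4+m}+X_{2,5+m}=0$; the recursion starts from the
   normalization $X_{24}=1$. *)
have := @law_jacobi 1 2 (4 + m) isT isT ltac:(lia).
rewrite law_coord3; last lia.
rewrite [X (_ + _) 1]law_coordN [X (_ + m) 1]law_coordN [X (_ + _) 2]law_coordN.
rewrite !law_coord1; try lia.
rewrite IHm; last lia.
rewrite !(mulN1r, mulrN1, mul1r, opprK) addn1 -addnS => /eqP.
by rewrite addrC addr_eq0 => /eqP ->; rewrite -natr1; ring.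
Qed.

(** The universal law over the coordinate ring is therefore [a4 n tau], and every law in the scheme
    is a specialization of it. *)
Lemma law_coordE i j : (i < j)%N -> X i j = a4_coef n tau i j.
Proof.
move=> ij; have [cij|cij] := boolP (is_coord4 n i j); last first.
  by rewrite a4_coef_out // law_coord_out //; apply/negP => /is_coord4_lt; lia.
have [[-> ->]|[i3 [j3 ijn]]] :
  (i = 1 /\ j = 2 \/ 0 < i <= 3 /\ 3 < j /\ i + j <= n)%N.
- by move: cij; rewrite /is_coord4 xpair_eqE; lia.
- by rewrite a4_coef1 ?law_coord1 //; lia.
have -> : j = (4 + (j - 4))%N by lia.
have [ei|[ei|ei]] : (i = 1 \/ i = 2 \/ i = 3)%N by lia.
all: subst i.
- by rewrite a4_coef1 ?law_coord1 //; lia.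
- rewrite a4_coef2 ?law_coord2; try lia.
  by congr (_ - _%:R * _); lia.
- by rewrite a4_coef3 ?law_coord3 //; lia.
Qed.

Lemma law_const_unit m : (0 < m)%N -> (law_const m%:R^-1 : L) * m%:R = 1.
Proof.
move=> m0; rewrite -(rmorph_nat (coord_const G)).
change (coord_const G m%:R^-1 *
  coord_const G m%:R = 1).
rewrite -rmorphM mulVf ?rmorph1 //.
by have /pcharf0P -> := charK; rewrite -lt0n.
Qed.

Lemma tau_eq0 : n = 6%N -> tau = 0.
Proof. by move=> n_6; apply: law_coord_out; rewrite n_6. Qed.

(** The relation for $(2,3,4)$ gives $-\tau(1-3\tau)+\tau=3\tau^2=0$, and 3 is invertible in
    characteristic $0$. *)
Lemma tau_sqr : (9 <= n)%N -> tau ^+ 2 = 0.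
Proof.
move=> n9; have := @law_jacobi 2 3 4 isT isT ltac:(lia).
rewrite (@law_coord_out 2 3) // mul0r add0r.
rewrite [X _ 2]law_coordN (@law_coord2 3) ?[X 4 2]law_coordN; last lia.
rewrite [X _ 3]law_coordN (@law_coord3 2) ?(@law_coord2 0); try lia.
move=> e; have e3 : 3%:R * tau ^+ 2 = 0 by rewrite -[RHS]e; ring.
by rewrite -[LHS]mul1r -(@law_const_unit 3) // -mulrA e3 mulr0.
Qed.

Lemma law_ind (Q : L -> Prop) :
  (forall c, Q (law_const c)) -> (forall x y, Q x -> Q y -> Q (x + y)) ->
  (forall x y, Q x -> Q y -> Q (x * y)) -> Q tau -> forall z, Q z.
Proof.
move=> QC QD QM Qt; apply: coord_ind => // k.
have Q0 : Q 0 by rewrite -(rmorph0 (coord_const _)); exact: QC.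
have Q1 : Q 1 by rewrite -(rmorph1 (coord_const _)); exact: QC.
have QN x : Q x -> Q (- x).
  move=> Qx; rewrite -mulN1r; apply: (QM) => //.
  by rewrite -(rmorph1 (coord_const _)) -rmorphN; exact: QC.
have Qnat m : Q m%:R.
  by rewrite -(rmorph_nat (coord_const _)); exact: QC.
case Eij : (nth (0, 0)%N (coord_pairs alpha n) k) => [i j].
have ijP : (i, j) \in coord_pairs alpha n by rewrite -Eij mem_nth.
(* The pair in position [k] is found again at index [k] because [coord_pairs] has no duplicates. *)
have <- : struct_const alpha n i j = 'X_k.
  rewrite struct_const_lt; last by apply: is_coord4_lt; rewrite -mem_coord_pairs4.
  rewrite /coord_var -Eij index_uniq ?valK //.
  rewrite filter_uniq // allpairs_uniq ?iota_uniq //.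
  by move=> [? ?] [? ?] _ _.
change (Q (X i j)); rewrite law_coordE; last first.
  by apply: is_coord4_lt; rewrite -mem_coord_pairs4.
rewrite /a4_coef; case: ifP => _ //; case: ifP => _; last by case: ifP.
by apply: (QD) => //; apply: QN; apply: QM.
Qed.

(** * Construction of points with values in a ring from solutions $t$ of the relations on [tau] *)

Section Eval.
Variables (B : comNzRingType) (h : {rmorphism K -> B}) (t : B).
Hypotheses (t6 : n = 6%N -> t = 0) (t9 : (9 <= n)%N -> t ^+ 2 = 0).

(** The antisymmetric extension, built like [struct_const] so as to be its image under
    evaluation. *)
Let c (i j : nat) := a4_coef n t i j - a4_coef n t j i.

Let c_lt i j : (i < j)%N -> c i j = a4_coef n t i j.
Proof.
move=> ij; rewrite /c [X in _ - X]a4_coef_out ?subr0 //.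
by apply/negP => /is_coord4_lt; lia.
Qed.

Let c_gt i j : (j < i)%N -> c i j = - a4_coef n t j i.
Proof.
move=> ij; rewrite /c [X in X - _]a4_coef_out ?sub0r //.
by apply/negP => /is_coord4_lt; lia.
Qed.

(** The relations for $(1,2,k)$ and $(1,3,k)$ hold identically in $t$. The one for $(2,3,k)$ amounts
    to $3t^2=0$ for every $k$, and it occurs only if $n\ge2+3+4=9$. *)
Lemma a4_jacobi i j k : (0 < i < j)%N -> (j <= 3 < k)%N -> (i + j + k <= n)%N ->
  c i j * c (i + j) k + c j k * c (j + k) i + c k i * c (k + i) j = 0.
Proof.
move=> ij jk ijk.
have [m km] : exists m, k = (4 + m)%N by exists (k - 4)%N; lia.
subst k; rewrite ![c (4 + m)%N _]c_gt; try lia.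
rewrite [c (j + _)%N _]c_gt; last lia.
rewrite [c (4 + m + _)%N _]c_gt; last lia.
rewrite [c i j]c_lt; last lia.
rewrite [c j _]c_lt; last lia.
have [[ei ej]|[[ei ej]|[ei ej]]] :
  (i = 1 /\ j = 2 \/ i = 1 /\ j = 3 \/ i = 2 /\ j = 3)%N by lia.
- subst i j; rewrite c_lt; last lia.
  rewrite !a4_coef1 ?a4_coef2 ?a4_coef3; try lia.
  have -> : (4 + m - 4 = m)%N by lia.
  have -> : (4 + m + 1 - 4 = m.+1)%N by lia.
  by rewrite -natr1; ring.
- subst i j; rewrite [a4_coef _ _ 1 3]a4_coef_out //.
  rewrite !a4_coef1 ?a4_coef3; try lia.
  by ring.
- subst i j; rewrite [a4_coef _ _ 2 3]a4_coef_out //.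
  rewrite !a4_coef2 ?a4_coef3; try lia.
  have -> : (4 + m - 4 = m)%N by lia.
  have -> : (3 + (4 + m) - 4 = m + 3)%N by lia.
  have t0 : t ^+ 2 = 0 by apply: t9; lia.
  by transitivity (3%:R * t ^+ 2); [rewrite natrD; ring | rewrite t0 mulr0].
Qed.

(** Converse to [tau_eq0] and [tau_sqr]: no further relation binds [tau]. Taking [B] to be [K],
    [{poly K}] or the dual numbers gives the rational points and the descriptions of the coordinate
    ring. *)
Lemma eval_law :
  exists f : {rmorphism L -> B}, (forall a, f (law_const a) = h a) /\ f tau = t.
Proof.
pose v (k : 'I_(size (coord_pairs alpha n))) :=
  let ij := nth (0, 0)%N (coord_pairs alpha n) k in a4_coef n t ij.1 ij.2.
have vV i j : mmap h v (coord_var alpha n i j) = a4_coef n t i j.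
  have [cij|cij] := boolP (is_coord4 n i j); last first.
    by rewrite coord_var_out // mmap0 a4_coef_out.
  rewrite /coord_var; case: insubP => /= [k _ ek|].
    by rewrite mmapX mmap1U /v ek nth_index // mem_coord_pairs4.
  by rewrite index_mem mem_coord_pairs4 // cij.
have vS i j : mmap h v (struct_const alpha n i j) = c i j by rewrite mmapB !vV.
have vR q : G q -> mmap h v q = 0.
  case=> [[i [j [k [ij jk ijk e ->]]]]|[[i j] /= Aij ->]].
    rewrite /jacobi !mmapD !rmorphM /= !vS a4_jacobi //.
    by apply/(jacobi_triple4 ij jk).
  rewrite mmapB vS rmorph1 /=; apply/eqP; rewrite subr_eq0; apply/eqP.
  have [[-> ->]|[-> jn]] : (i = 2 /\ j = 4 \/ i = 1 /\ (1 < j < n) && (j != 3))%N.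
  - by move: Aij; rewrite /A4 xpair_eqE /=; lia.
  - by rewrite c_lt // a4_coef2 // mul0r subr0.
  - by rewrite c_lt ?a4_coef1 //; lia.
have [f [fE fC]] := coord_lift vR.
exists f; split=> [a|]; first exact: fC.
(* For $n=6$ the pair $(3,4)$ carries no coordinate, so [tau] goes to $0$, which is $t$ by [t6]. *)
rewrite [LHS]fE vS c_lt //; have [n7|n7] := leqP 7 n; first by rewrite a4_coef3.
by rewrite t6 ?a4_coef_out //; rewrite /is_coord4 ?xpair_eqE; lia.
Qed.

End Eval.

Lemma law_alongE (B : pzRingType) (f : {rmorphism L -> B}) :
  law_along f =2 a4 n (f tau).
Proof.
move=> u v; apply: eq_bigr => i _; apply: eq_bigr => j ij; congr (_ *: _).
by rewrite a4_bracketE law_coordE ?ltnS // rmorph_a4_coef.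
Qed.

End LawRing.
End Weights.

(** * Rational points and local rings in the three ranges of $n$ *)

Section Points.
Variables (K : fieldType) (charK : [pchar K] =i pred0).
Variables (T : vectType K) (alpha1 alpha4 : 'Hom(T, K^o)).
Hypothesis indep : free [:: alpha1; alpha4].
Variables (n : nat) (n6 : (6 <= n)%N).

Local Notation alpha := (weights4 alpha1 alpha4).
Local Notation L := (law_ring alpha n (A4 n)).
Local Notation G := (@normalized_relation K T alpha n (A4 n)).
Local Notation tau := (law_coord alpha n (A4 n) 3 4).

Lemma law_constD a b : law_const (a + b) = law_const a + law_const b :> L.
Proof. exact: (rmorphD (coord_const G)). Qed.

Lemma law_constM a b : law_const (a * b) = law_const a * law_const b :> L.
Proof. exact: (rmorphM (coord_const G)). Qed.

Lemma law_const0 : law_const 0 = 0 :> L.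
Proof. exact: (rmorph0 (coord_const G)). Qed.

Lemma law_const1 : law_const 1 = 1 :> L.
Proof. exact: (rmorph1 (coord_const G)). Qed.

Lemma exists_point (t : K) : (n = 6%N -> t = 0) -> ((9 <= n)%N -> t ^+ 2 = 0) ->
  exists x : law_point alpha n (A4 n), x tau = t.
Proof.
move=> t6 t9.
have [f [fC ft]] := eval_law charK indep n6 idfun t6 t9.
by exists (Point fC).
Qed.

(** A rational point [x] is determined by the parameter [x tau], subject to the same relations as
    [tau]. *)
Lemma is_law4 mu :
  is_law alpha n (A4 n) mu <->
  exists t : K, [/\ n = 6%N -> t = 0, (9 <= n)%N -> t ^+ 2 = 0 & mu =2 a4 n t].
Proof.
split=> [[x xmu]|[t [t6 t9 mut]]].
  exists (x tau); split=> [n_6|n9|u v].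
  - by rewrite (tau_eq0 charK indep n6) ?rmorph0.
  - by rewrite -rmorphXn /= (tau_sqr charK indep n6) ?rmorph0.
  - by rewrite -xmu (law_alongE charK indep n6).
have [x xt] := exists_point t6 t9.
by exists x => u v; rewrite (law_alongE charK indep n6) mut -xt.
Qed.

(** For $n=7,8$ no relation is imposed on [tau]. The shift by [a] serves to move a given point to
    the origin of the line. *)
Lemma law_polyP (a : K) : (n <= 8)%N -> n != 6%N ->
  exists psi : {rmorphism L -> {poly K}},
    [/\ bijective psi, forall c, psi (law_const c) = c%:P
      & psi tau = 'X + a%:P].
Proof.
move=> n8 n_6.
have [psi [psiC psit]] := eval_law charK indep n6 polyC
  (t := 'X + a%:P) ltac:(lia) ltac:(lia).
exists psi; split=> //.
(* Having a morphism to [{poly K}], the coordinate ring is nonzero and can be packed as a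
   [comNzRingType], in which polynomials are evaluated. *)
have L1 : (1 : L) != 0.
  apply/eqP => /(congr1 psi); rewrite rmorph1 rmorph0 => /eqP.
  by rewrite oner_eq0.
pose L' : comNzRingType := HB.pack L (GRing.PzSemiRing_isNonZero.Build L L1).
pose cst : {rmorphism K -> L'} := coord_const G.
pose u : L' := tau - law_const a.
(* The inverse of [psi] is evaluation at [tau - law_const a]. *)
have comm_u : commr_rmorph cst u by move=> c; apply: mulrC.
pose phi : {poly K} -> L := horner_morph comm_u.
have phiD p q : phi (p + q) = phi p + phi q by exact: (rmorphD (horner_morph comm_u)).
have phiM p q : phi (p * q) = phi p * phi q by exact: (rmorphM (horner_morph comm_u)).
have phiX : phi 'X = tau - law_const a by exact: (horner_morphX comm_u).
have phiC c : phi c%:P = law_const c by exact: (horner_morphC comm_u).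
exists phi.
- apply: (law_ind charK indep n6) => [c|y z py pz|y z py pz|].
  + by rewrite psiC phiC.
  + by rewrite rmorphD phiD py pz.
  + by rewrite rmorphM phiM py pz.
  + by rewrite psit phiD phiX phiC subrK.
- elim/poly_ind => [|p c IHp]; first by rewrite -polyC0 phiC psiC.
  rewrite phiD phiM phiX phiC rmorphD rmorphM rmorphB /= IHp psit !psiC.
  by rewrite addrK.
Qed.

Lemma law_span6 : n = 6%N -> forall z : L, exists a, z = law_const a.
Proof.
move=> n_6; apply: (law_ind charK indep n6).
- by move=> c; exists c.
- by move=> _ _ [a ->] [b ->]; exists (a + b); rewrite law_constD.
- by move=> _ _ [a ->] [b ->]; exists (a * b); rewrite law_constM.
- by exists 0; rewrite (tau_eq0 charK indep n6) // law_const0.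
Qed.

Lemma law_span9 : (9 <= n)%N ->
  forall z : L, exists a b, z = law_const a + law_const b * tau.
Proof.
move=> n9; have t2 := tau_sqr charK indep n6 n9.
apply: (law_ind charK indep n6).
- by move=> c; exists c, 0; rewrite law_const0 mul0r addr0.
- move=> _ _ [a [b ->]] [c [d ->]]; exists (a + c), (b + d).
  by rewrite !law_constD mulrDl addrACA.
- move=> _ _ [a [b ->]] [c [d ->]]; exists (a * c), (a * d + b * c).
  rewrite !(law_constD, law_constM).
  move: (law_const a) (law_const b) (law_const c) (law_const d) => {}a {}b {}c {}d.
  transitivity (a * c + (a * d + b * c) * tau + b * d * tau ^+ 2); first by ring.
  by rewrite t2 mulr0 addr0.
- by exists 0, 1; rewrite law_const0 law_const1 add0r mul1r.
Qed.

Variable x : law_point alpha n (A4 n).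

Let xC c : x (law_const c) = c. Proof. exact: point_evalC. Qed.

Lemma germ_bij6 : n = 6%N -> bijective (germ x).
Proof.
move=> n_6; apply: germ_bij => s; have [a ->] := law_span6 n_6 s.
rewrite xC => a0; exists (coord_const G a^-1).
by rewrite -rmorphM mulVf // rmorph1.
Qed.

Lemma point_tau9 : (9 <= n)%N -> x tau = 0.
Proof.
move=> n9; apply/eqP; have : x tau ^+ 2 == 0.
  by rewrite -rmorphXn /= (tau_sqr charK indep n6) ?rmorph0.
by rewrite expf_eq0.
Qed.

Lemma germ_bij9 : (9 <= n)%N -> bijective (germ x).
Proof.
move=> n9; apply: germ_bij => s; have [a [b ->]] := law_span9 n9 s.
rewrite rmorphD rmorphM /= !xC point_tau9 // mulr0 addr0 => a0.
have a1 : law_const a^-1 * law_const a = 1 :> L.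
  by rewrite -law_constM mulVf // law_const1.
have t2 := tau_sqr charK indep n6 n9.
(* The geometric series for $(a+b\tau)^{-1}$ stops after the linear term because $\tau^2=0$. *)
exists (law_const a^-1 - law_const a^-1 ^+ 2 * law_const b * tau).
move: (law_const a) (law_const a^-1) (law_const b) a1 => {a0}a a' {}b a1.
transitivity (a' * a + a' * b * tau * (1 - a' * a) - (a' * b) ^+ 2 * tau ^+ 2).
  by ring.
by rewrite a1 t2 subrr !mulr0 subr0 addr0.
Qed.

Lemma local_ring6 : n = 6%N ->
  exists theta : {lrmorphism local_ring x -> K^o}, bijective theta.
Proof.
move=> n_6.
pose f : {rmorphism coord_ring G -> K^o} := point_eval x.
apply: (stalk_iso (germ_bij6 n_6) (f := f)).
- exists (fun c => law_const (c : K)) => [z|c]; last exact: xC.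
  have [a ->] := law_span6 n_6 z; congr law_const; exact: xC.
- by move=> c; rewrite [LHS]xC [RHS]mulr1.
Qed.

Local Notation B := {poly %/ 'X^2 : {poly K}}.

(** Sending [tau] to the class of ['X] shows that the spanning family $1,\tau$ is free; in
    particular [tau] is nonzero. *)
Lemma law_dual9 : (9 <= n)%N ->
  exists f : {rmorphism L -> B},
    [/\ bijective f, forall c, f (law_const c) = c%:A & f tau != 0].
Proof.
move=> n9.
(* The quotient ring is defined modulo [mk_monic 'X^2], which has to be identified with ['X^2]
   itself. *)
have X2 : mk_monic ('X^2 : {poly K}) = 'X^2 by exact: mk_monic_Xn.
pose q : B := in_qpoly 'X^2 'X.
have q2 : q ^+ 2 = 0.
  rewrite -rmorphXn /=; apply: val_inj; rewrite /= X2.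
  by rewrite Pdiv.RingMonic.rmodpp ?monicXn.
have [f [fC ft]] := eval_law charK indep n6 (qpolyC ('X^2 : {poly K}))
  (t := q) ltac:(lia) (fun _ => q2).
have qE : val q = 'X by apply: in_qpoly_small; rewrite X2 size_polyXn size_polyX.
have {}fC c : f (law_const c) = c%:A.
  rewrite fC; apply: val_inj; rewrite [LHS]qpolyCE [RHS]poly_of_qpolyZ.
  by rewrite -alg_polyC.
have fE a b : val (f (law_const a + law_const b * tau)) = a%:P + b *: 'X.
  rewrite rmorphD rmorphM !fC ft mulr_algl.
  by rewrite [LHS]poly_of_qpolyD !poly_of_qpolyZ [X in _ + _ *: X]qE -alg_polyC.
exists f; split.
(* The inverse reads off the two coefficients of the representative, whose degree is at most 1. *)
- exists (fun p : B => law_const (val p)`_0 + law_const (val p)`_1 * tau).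
    move=> z; have [a [b ->]] := law_span9 n9 z.
    by rewrite fE !coefE /= mulr0 mulr1 addr0 add0r.
  move=> p; apply: val_inj; rewrite fE; apply/polyP => i.
  rewrite !coefE; case: i => [|[|i]] /=; rewrite ?mulr0 ?mulr1 ?addr0 ?add0r //.
  rewrite nth_default //; apply: leq_trans (size_npoly p) _.
  by rewrite X2 size_polyXn.
- by move=> c; rewrite fC.
- apply/eqP => /(congr1 val); rewrite ft qE => /eqP.
  by rewrite polyX_eq0.
Qed.

(** With [x] moved to the origin, a function is a denominator at [x] exactly when its polynomial
    does not vanish at $0$. The local ring thus becomes the localization of $\mathbb K[u]$ at $0$
    inside $\mathbb K(u)$. *)
Lemma local_ring_frac : (n <= 8)%N -> n != 6%N ->
  exists theta : {rmorphism local_ring x -> {fraction {poly K}}},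
    [/\ injective theta, forall c : K, theta c%:A = tofrac c%:P
      & forall f, (exists z, theta z = f) <-> regular_at0 f].
Proof.
move=> n8 n_6; have [psi [[phi psiK phiK] psiC psit]] := law_polyP (x tau) n8 n_6.
have psi0 s : (psi s).[0] = x s.
  elim/(law_ind charK indep n6): s => [c|y z IHy IHz|y z IHy IHz|].
  - by rewrite psiC hornerC xC.
  - by rewrite !rmorphD hornerD IHy IHz.
  - by rewrite !rmorphM hornerM IHy IHz.
  - by rewrite psit hornerD hornerX hornerC add0r.
have psi_eq0 s : psi s = 0 -> s = 0.
  by move=> s0; rewrite -[s]psiK s0 -(rmorph0 psi) psiK.
pose f : {rmorphism L -> {fraction {poly K}}} := @tofrac _ \o psi.
have [s xs|theta thetaE] := @stalk_lift _ _ _ x _ f.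
  rewrite /= tofrac_eq0; apply/eqP => s0.
  by move: xs; rewrite -psi0 s0 horner0 eqxx.
have den_neq0 (s : {s : coord_ring G | x s != 0}) : tofrac (psi (val s)) != 0.
  rewrite tofrac_eq0; apply/eqP => /psi_eq0 s0.
  by have := valP s; rewrite /= s0 rmorph0 eqxx.
have theta_eq0 z : theta z = 0 -> z = 0.
  elim/stalk_class_ind: z => z /eqP.
  rewrite thetaE mulf_eq0 invr_eq0 (negbTE (den_neq0 _)) orbF /= tofrac_eq0.
  move=> /eqP/psi_eq0 z0; apply/stalk_classP/stalk_equivP.
  by exists 1; rewrite ?rmorph1 ?oner_neq0 // z0 !mul0r subrr mulr0.
exists theta; split; first exact: raddf_inj.
- move=> c; rewrite -germ_constE; have := thetaE (coord_const G c, den1 x).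
  by rewrite /= !rmorph1 divr1 psiC.
move=> r; split=> [[z <-]|[p [q [q0 ->]]]].
  elim/stalk_class_ind: z => z; exists (psi z.1), (psi (val z.2)).
  by rewrite psi0 thetaE; split=> //; exact: (valP z.2).
have xq : x (phi q) != 0 by rewrite -psi0 phiK.
by exists (stalk_class (phi p, Sub (phi q) xq)); rewrite thetaE /= !phiK.
Qed.

Lemma local_ring9 : (9 <= n)%N ->
  (exists t : local_ring x,
     [/\ t ^+ 2 = 0, t != 0, canonical_deformation x =2 a4 n t
       & forall z, exists a b : K, z = a%:A + b *: t])
  /\ exists theta : {lrmorphism local_ring x -> {poly %/ 'X^2 : {poly K}}},
       bijective theta.
Proof.
move=> n9; have gbij := germ_bij9 n9; have [f [fbij fC ft]] := law_dual9 n9.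
split; last exact: stalk_iso gbij fbij fC.
have [g germK gK] := gbij.
exists (germ x tau); split.
- by rewrite -rmorphXn (tau_sqr charK indep n6) ?rmorph0.
(* [germ x] is injective, so a zero germ would force [tau], hence its nonzero image [f tau], to
   vanish. *)
- by apply: contraNneq ft => t0; rewrite -[tau]germK t0 -(rmorph0 (germ x)) germK rmorph0.
- exact: (law_alongE charK indep n6 (germ x)).
move=> z; have [a [b gz]] := law_span9 n9 (g z); exists a, b.
have cE c : germ x (law_const c) = c%:A by exact: germ_constE.
by rewrite -[z]gK gz rmorphD rmorphM /= !cE mulr_algl.
Qed.

End Points.

Theorem theorem6p1 (K : closedFieldType) (charK : [pchar K] =i pred0)
    (T : vectType K) (dimT : \dim {: T} = 2%N)
    (alpha1 alpha4 : 'Hom(T, K^o)) (indep : free [:: alpha1; alpha4]) :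
  let alpha := weights4 alpha1 alpha4 in
  [/\ (forall mu, is_law alpha 6 (A4 6) mu <-> mu =2 a4 6 (0 : K))
      /\ (forall x : law_point alpha 6 (A4 6),
            exists theta : {lrmorphism local_ring x -> K^o}, bijective theta),
      (forall n : nat, n = 7%N \/ n = 8%N ->
        [/\ (forall mu, is_law alpha n (A4 n) mu <-> exists t : K, mu =2 a4 n t),
            (exists theta : {rmorphism law_ring alpha n (A4 n) -> {poly K}},
               [/\ bijective theta, forall c, theta (law_const c) = c%:P
                 & law_along theta =2 a4 n 'X])
          & forall x : law_point alpha n (A4 n),
              exists theta : {rmorphism local_ring x -> {fraction {poly K}}},
                [/\ injective theta,
                    forall c : K, theta c%:A = tofrac c%:P
                  & forall f, (exists z, theta z = f) <-> regular_at0 f]])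
    & (forall n : nat, (9 <= n)%N ->
        (forall mu, is_law alpha n (A4 n) mu <-> mu =2 a4 n (0 : K))
        /\ (forall x : law_point alpha n (A4 n),
              (exists t : local_ring x,
                 [/\ t ^+ 2 = 0, t != 0,
                     canonical_deformation x =2 a4 n t
                   & forall z, exists a b : K, z = a%:A + b *: t])
              /\ exists theta : {lrmorphism local_ring x -> {poly %/ 'X^2 : {poly K}}},
                   bijective theta)) ].
Proof.
move=> alpha; split.
- split=> [mu|x]; last exact: local_ring6.
  rewrite (is_law4 charK indep (n := 6)) //; split=> [[t [t6 _ mut]]|mu0].
    by rewrite -(t6 erefl).
  by exists 0; split.
- move=> n n78; have n6 : (6 <= n)%N by lia.
  have n8 : (n <= 8)%N by lia.
  have n_6 : n != 6%N by lia.
  split=> [mu||x]; last exact: local_ring_frac.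
    rewrite (is_law4 charK indep) //; split=> [[t [_ _ mut]]|[t mut]]; exists t => //.
    by split=> // ?; lia.
  (* With shift $0$ the image of [tau] is ['X], so the universal law becomes [a4 n 'X]. *)
  have [theta [thetaK thetaC thetat]] :=
    law_polyP charK indep n6 0 n8 n_6.
  exists theta; split=> //; rewrite -['X]addr0 -polyC0 -thetat.
  exact: law_alongE.
move=> n n9; have n6 : (6 <= n)%N by lia.
split=> [mu|x]; last exact: local_ring9.
(* Over the field [K], $t^2=0$ forces $t=0$; the nilpotent parameter is visible only in the local
   ring. *)
rewrite (is_law4 charK indep) //; split=> [[t [_ /(_ n9)/eqP]]|mu0].
  by rewrite expf_eq0 => /= /eqP->.
by exists 0; split=> // _; rewrite expr0n.
Qed.
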